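(* Let $\mathcal{V}$ be any variety of $\mathcal{L}$-algebras such that $D\in\mathcal{V}$ and $\mathcal{V}\subseteq\mathcal{V}_0$, and let $\operatorname{F}_{\mathcal{V}}(I)$ denote the free $\mathcal{V}$-algebra on a set $I$. For every set $I$, the spectrum $\Omega_I$ of the underlying distributive lattice of $\operatorname{F}_{\mathcal{V}}(I)$ is a completely normal spectral space. Moreover, if $\operatorname{card} I\geq\aleph_2$, then $\Omega_I$ cannot be embedded, as a spectral subspace, into the $\ell$-spectrum of any Abelian $\ell$-group (that is, $\Omega_I$ is not homeomorphic to any spectral subspace of such an $\ell$-spectrum).
   Context: ''Compact'' does not include Hausdorff. A topological space is sober if every join-irreducible member of the lattice of its closed subsets is the closure of a unique singleton. It is generalized spectral if it is sober, its compact open subsets form a basis, and the intersection of any two compact open subsets is compact; it is spectral if moreover it is compact. A (generalized) spectral space is completely normal if for all points $x,y,z$ with $x,y$ in the closure of $\{z\}$, either $x$ is in the closure of $\{y\}$ or $y$ is in the closure of $\{x\}$. A map between topological spaces is spectral if the inverse image of every compact open set is compact open. A generalized spectral space $X$ is a spectral subspace of a generalized spectral space $Y$ if $X\subseteq Y$, $X$ carries the topology induced by $Y$, and the inclusion map $X\to Y$ is spectral. The spectrum of a distributive lattice $L$ with zero is the set of all proper prime ideals of $L$, with closed sets the sets $\{P: J\subseteq P\}$ for $J\subseteq L$. An $\ell$-group is a group with a translation-invariant lattice ordering. An $\ell$-ideal of an Abelian $\ell$-group $G$ is a subgroup that is also an order-convex sublattice. A prime $\ell$-ideal is a proper $\ell$-ideal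 $P$ such that $x\wedge y\in P$ implies $x\in P$ or $y\in P$. The $\ell$-spectrum of $G$ is the set of all prime $\ell$-ideals of $G$, with closed sets exactly the sets $\{P : J\subseteq P\}$ for $J\subseteq G$. Let $\mathcal{L}=(\vee,\wedge,\smallsetminus,0,1)$ with $\vee,\wedge,\smallsetminus$ binary operation symbols and $0,1$ constants. $\mathcal{V}_0$ is the variety of $\mathcal{L}$-structures defined by the identities of bounded distributive lattices for $(\vee,\wedge,0,1)$ together with $(x\wedge y)\vee(x\smallsetminus y)=x$ and $(x\smallsetminus y)\wedge(y\smallsetminus x)=0$. The cube. Let $\mathbf{2}=\{0,1\}$ and $\mathbf{3}=\{0,1,2\}$ be chains with their natural order. Put $\overline{0}=0$, $\overline{1}=\overline{2}=2$. Let $\boldsymbol{e}\colon\mathbf{2}\to\mathbf{3}$, $0\mapsto0$, $1\mapsto2$; let $\boldsymbol{r}\colon\mathbf{3}\to\mathbf{2}$ send $0$ to $0$ and $1,2$ to $1$. Define $\boldsymbol{f},\boldsymbol{g}\colon\mathbf{3}\to\mathbf{3}^2$ by $\boldsymbol{f}(x)=(\overline{x},x)$, $\boldsymbol{g}(x)=(x,\overline{x})$, and $\boldsymbol{a},\boldsymbol{b},\boldsymbol{c}\colon\mathbf{3}^2\to\mathbf{3}^3\times\mathbf{2}$ by $\boldsymbol{a}(x,y)=(\overline{x},x,y,\boldsymbol{r}(y))$, $\boldsymbol{b}(x,y)=(x,\overline{x},y,\boldsymbol{r}(x))$, $\boldsymbol{c}(x,y)=(x,y,\overline{y},\boldsymbol{r}(y))$.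 Consider the commutative diagram of bounded lattice embeddings indexed by the subsets of $\{1,2,3\}$, with $D_{\varnothing}=\mathbf{2}$, $D_1=D_2=D_3=\mathbf{3}$, $D_{1,2}=D_{1,3}=D_{2,3}=\mathbf{3}^2$, $D_{1,2,3}=\mathbf{3}^3\times\mathbf{2}$, and arrows: $\boldsymbol{e}\colon D_\varnothing\to D_i$ for $i=1,2,3$; $\boldsymbol{f}\colon D_1\to D_{1,2}$, $\boldsymbol{f}\colon D_1\to D_{1,3}$, $\boldsymbol{g}\colon D_2\to D_{1,2}$, $\boldsymbol{f}\colon D_2\to D_{2,3}$, $\boldsymbol{g}\colon D_3\to D_{1,3}$, $\boldsymbol{g}\colon D_3\to D_{2,3}$; $\boldsymbol{a}\colon D_{1,2}\to D_{1,2,3}$, $\boldsymbol{b}\colon D_{1,3}\to D_{1,2,3}$, $\boldsymbol{c}\colon D_{2,3}\to D_{1,2,3}$. Binary operations $\smallsetminus$ can be chosen on all the lattices $D_p$ ($p\subseteq\{1,2,3\}$) so that every $D_p$ becomes a member of $\mathcal{V}_0$ and all the arrows of the diagram become embeddings of $\mathcal{L}$-structures. Fix such a choice, and let $D=D_{1,2,3}=(\mathbf{3}^3\times\mathbf{2},\vee,\wedge,\smallsetminus,0,1)$ be the resulting $\mathcal{L}$-structure. *)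

(* Defs.v *)
From HB Require Import structures.
From mathcomp Require Import all_boot all_order.
From mathcomp Require Import all_classical.
From mathcomp Require Import reals topology.

Set Implicit Arguments.
Unset Strict Implicit.
Unset Printing Implicit Defensive.

Import Order.TTheory.

Local Open Scope classical_set_scope.

Section SpectralSpaces.
Implicit Types X Y : topologicalType.

(* The zero of a lattice (here the empty closed set) is never join-irreducible. *)
Definition join_irreducible_closed X (A : set X) : Prop :=
  [/\ closed A, A !=set0 &
    forall B C : set X, closed B -> closed C -> A = B `|` C -> A = B \/ A = C].

Definition sober X : Prop :=
  forall A : set X, join_irreducible_closed A ->
    exists! x : X, A = closure [set x].

Definition compact_open X : set (set X) := [set U | compact U /\ open U].

Definition generalized_spectral X : Prop :=
  [/\ sober X, basis (@compact_open X) &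
    forall U V : set X, compact_open U -> compact_open V -> compact (U `&` V)].

Definition spectral X : Prop := generalized_spectral X /\ compact [set: X].

Definition completely_normal X : Prop :=
  forall x y z : X, closure [set z] x -> closure [set z] y ->
    closure [set y] x \/ closure [set x] y.

Definition spectral_map X Y (f : X -> Y) : Prop :=
  forall U : set Y, compact_open U -> compact_open (f @^-1` U).

(* [set_type X] carries the topology induced by [Y]. *)
Definition spectral_subspace Y (X : set Y) : Prop :=
  [/\ generalized_spectral (set_type X), generalized_spectral Y &
    spectral_map (set_val : set_type X -> Y)].

Definition homeomorphic X Y : Prop :=
  exists (f : X -> Y) (g : Y -> X),
    [/\ cancel f g, cancel g f, continuous f & continuous g].

End SpectralSpaces.

Section HullKernel.
Context {T : Type} {Q : set T -> Prop}.
Local Notation S := {P : set T | Q P}.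

Definition hull (J : set T) : set S := [set P | J `<=` sval P].

Definition hk_open : set (set S) := [set U | exists J, U = ~` hull J].

Context (Qproper : forall P, Q P -> P <> setT).
Context (m : T -> T -> T).
Context (Qm : forall P, Q P -> forall x y, P (m x y) <-> P x \/ P y).

Lemma hk_openT : hk_open setT.
Proof.
exists setT; apply/seteqP; split => // -[P QP] _ /= PT.
by apply: (Qproper QP); apply/seteqP; split.
Qed.

Lemma hk_openI : setI_closed hk_open.
Proof.
move=> _ _ [J ->] [J' ->]; exists [set z | exists x y, [/\ J x, J' y & z = m x y]].
rewrite -setCU; congr (~` _); apply/seteqP; split => -[P QP] /=.
  by move=> H _ [x [y [Jx J'y ->]]]; apply/Qm => //; case: H => H;
    [left; apply: H | right; apply: H].
move=> H; have [JP|/existsNP[x /not_implyP[Jx nPx]]] := pselect (J `<=` P).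
  by left.
right => y J'y; have /(Qm QP)[/nPx//|//] : P (m x y).
by apply: H; exists x, y.
Qed.

Lemma hk_open_bigU (I : Type) (f : I -> set S) :
  (forall i, hk_open (f i)) -> hk_open (\bigcup_i f i).
Proof.
move=> fo; exists [set x | exists i J, f i = ~` hull J /\ J x].
rewrite -[LHS]setCK setC_bigcup; congr (~` _); apply/seteqP; split => -[P QP] /=.
  move=> H x [i [J [fi Jx]]]; have := H i Logic.I; rewrite fi setCK; exact.
move=> H i _ fiP; have [J fiJ] := fo i; move: fiP; rewrite fiJ; apply => x Jx.
by apply: H; exists i, J.
Qed.

End HullKernel.

Section LatticeSpectrum.
Context {d : Order.disp_t} (L : bDistrLatticeType d).
Local Open Scope order_scope.

Record prime_ideal (P : set L) : Prop := PrimeIdeal {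
  pi_bot : P \bot;
  pi_join : forall x y, P x -> P y -> P (x `|` y);
  pi_down : forall x y, x <= y -> P y -> P x;
  pi_proper : P <> setT;
  pi_prime : forall x y, P (x `&` y) -> P x \/ P y }.

Definition spectrum : Type := {P : set L | prime_ideal P}.

HB.instance Definition _ := gen_eqMixin spectrum.
HB.instance Definition _ := gen_choiceMixin spectrum.

Lemma prime_idealI (P : set L) : prime_ideal P ->
  forall x y, P (x `&` y) <-> P x \/ P y.
Proof.
move=> hP x y; split; first exact: pi_prime.
by case; apply: pi_down => //; rewrite ?leIl ?leIr.
Qed.

HB.instance Definition _ := @isOpenTopological.Build spectrum
  (@hk_open L prime_ideal) (hk_openT pi_proper) (hk_openI prime_idealI)
  (@hk_open_bigU L prime_ideal).

End LatticeSpectrum.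

(* The group law is written multiplicatively: [zmodType] already has a join
   with [porderType ring_display] in the library, which prevents joining it
   with [latticeType] here, whereas [groupType] can be. *)
HB.mixin Record isAbelianLGroup d (G : Type)
    of Order.Lattice d G & monoid.Group G := {
  lg_mulC : forall x y : G, (x * y = y * x)%g;
  lg_le2M : forall z x y : G, (x <= y)%O -> ((z * x)%g <= (z * y)%g)%O }.

#[short(type="abLGroupType")]
HB.structure Definition AbLGroup d :=
  {G of Order.Lattice d G & monoid.Group G & isAbelianLGroup d G}.

Section LSpectrum.
Context {d : Order.disp_t} (G : abLGroupType d).
Local Open Scope group_scope.
Local Open Scope order_scope.

Record l_ideal (P : set G) : Prop := {
  li_one : P 1%g;
  li_mul : forall x y, P x -> P y -> P (x * y)%g;
  li_inv : forall x, P x -> P (x^-1)%g;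
  li_convex : forall x y z, x <= y -> y <= z -> P x -> P z -> P y;
  li_meet : forall x y, P x -> P y -> P (x `&` y);
  li_join : forall x y, P x -> P y -> P (x `|` y) }.

Record prime_l_ideal (P : set G) : Prop := {
  pli_ideal : l_ideal P;
  pli_proper : P <> setT;
  pli_prime : forall x y, P (x `&` y) -> P x \/ P y }.

Definition l_spectrum : Type := {P : set G | prime_l_ideal P}.

HB.instance Definition _ := gen_eqMixin l_spectrum.
HB.instance Definition _ := gen_choiceMixin l_spectrum.

(* The absolute value of [x], written so that [1 <= labs x] is immediate. *)
Let labs (x : G) : G := (x `|` x^-1) `|` 1%g.

Let le_inv (x y : G) : x^-1%g <= y -> y^-1%g <= x.
Proof.
move=> /(lg_le2M (x * y^-1)%g).
by rewrite mulgVK (lg_mulC x) mulgK.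
Qed.

Let l_ideal_labs (P : set G) x : l_ideal P -> P (labs x) <-> P x.
Proof.
move=> iP; split=> Px.
  apply: (@li_convex _ iP (labs x)^-1%g x (labs x)) => //.
  - by apply: le_inv; rewrite /labs lexU2 // leUr.
  - by rewrite /labs lexU2 // leUl.
  - exact: li_inv.
by apply: li_join => //; [apply: li_join => //; apply: li_inv | apply: li_one].
Qed.

Lemma prime_l_idealI (P : set G) : prime_l_ideal P ->
  forall x y, P (labs x `&` labs y) <-> P x \/ P y.
Proof.
move=> hP x y; have iP := pli_ideal hP; split.
  by move=> /(pli_prime hP)[] /(l_ideal_labs _ iP); [left|right].
have labs_ge1 z : 1%g <= labs z by rewrite leUr.
by case=> /(l_ideal_labs _ iP) Pz; apply: (li_convex iP _ _ (li_one iP) Pz);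
  rewrite ?lexI ?labs_ge1 ?leIl ?leIr.
Qed.

HB.instance Definition _ := @isOpenTopological.Build l_spectrum
  (@hk_open G prime_l_ideal) (hk_openT pli_proper) (hk_openI prime_l_idealI)
  (@hk_open_bigU G prime_l_ideal).

End LSpectrum.

Record LStr : Type := MkLStr {
  car :> Type;
  ljoin : car -> car -> car;
  lmeet : car -> car -> car;
  ldiff : car -> car -> car;
  lzero : car;
  lone : car }.

Arguments lzero {_}.
Arguments lone {_}.

Record Lhom (A B : LStr) (h : A -> B) : Prop := {
  Lhom_join : forall x y, h (ljoin x y) = ljoin (h x) (h y);
  Lhom_meet : forall x y, h (lmeet x y) = lmeet (h x) (h y);
  Lhom_diff : forall x y, h (ldiff x y) = ldiff (h x) (h y);
  Lhom_zero : h lzero = lzero;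
  Lhom_one : h lone = lone }.

Definition Lembedding (A B : LStr) (h : A -> B) : Prop :=
  Lhom h /\ injective h.

Inductive Lterm : Type :=
  | tvar of nat
  | tjoin of Lterm & Lterm
  | tmeet of Lterm & Lterm
  | tdiff of Lterm & Lterm
  | tzero
  | tone.

Fixpoint Leval (A : LStr) (v : nat -> A) (t : Lterm) : A :=
  match t with
  | tvar n => v n
  | tjoin t1 t2 => ljoin (Leval v t1) (Leval v t2)
  | tmeet t1 t2 => lmeet (Leval v t1) (Leval v t2)
  | tdiff t1 t2 => ldiff (Leval v t1) (Leval v t2)
  | tzero => lzero
  | tone => lone
  end.

Definition satisfies (A : LStr) (E : set (Lterm * Lterm)) : Prop :=
  forall t1 t2, E (t1, t2) -> forall v : nat -> A, Leval v t1 = Leval v t2.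

Definition is_variety (V : LStr -> Prop) : Prop :=
  exists E : set (Lterm * Lterm), forall A : LStr, V A <-> satisfies A E.

Record V0 (A : LStr) : Prop := {
  V0_joinC : forall x y : A, ljoin x y = ljoin y x;
  V0_meetC : forall x y : A, lmeet x y = lmeet y x;
  V0_joinA : forall x y z : A, ljoin x (ljoin y z) = ljoin (ljoin x y) z;
  V0_meetA : forall x y z : A, lmeet x (lmeet y z) = lmeet (lmeet x y) z;
  V0_joinK : forall x y : A, lmeet x (ljoin x y) = x;
  V0_meetK : forall x y : A, ljoin x (lmeet x y) = x;
  V0_meetUl : forall x y z : A,
    lmeet (ljoin x y) z = ljoin (lmeet x z) (lmeet y z);
  V0_join0 : forall x : A, ljoin lzero x = x;
  V0_meet1 : forall x : A, lmeet lone x = x;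
  V0_diffE : forall x y : A, ljoin (lmeet x y) (ldiff x y) = x;
  V0_diffI : forall x y : A, lmeet (ldiff x y) (ldiff y x) = lzero }.

Record is_free (V : LStr -> Prop) (I : Type) (F : LStr) (eta : I -> F)
    : Prop := {
  free_mem : V F;
  free_ext : forall A : LStr, V A -> forall f : I -> A,
    exists! h : F -> A, Lhom h /\ forall i, h (eta i) = f i }.

Definition reduct (A : LStr) (hA : V0 A) : Type := car A.

Section Reduct.
Local Open Scope order_scope.
Context (A : LStr) (hA : V0 A).
Local Notation T := (reduct hA).

HB.instance Definition _ := gen_eqMixin T.
HB.instance Definition _ := gen_choiceMixin T.

Let join : T -> T -> T := @ljoin A.
Let meet : T -> T -> T := @lmeet A.
Let le : rel T := fun x y => meet x y == x.
Let lt : rel T := fun x y => (y != x) && le x y.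

Let joinKI (y x : T) : meet x (join x y) = x. Proof. exact: V0_joinK. Qed.
Let meetKU (y x : T) : join x (meet x y) = x. Proof. exact: V0_meetK. Qed.
Let meetxx : idempotent_op meet.
Proof. by move=> x; rewrite -{2}(meetKU x x) joinKI. Qed.

HB.instance Definition _ :=
  @Order.isMeetJoinDistrLattice.Build Order.default_display T le lt meet join
    (fun _ _ => erefl) (fun _ _ => erefl) (V0_meetC hA) (V0_joinC hA)
    (V0_meetA hA) (V0_joinA hA) joinKI meetKU (V0_meetUl hA) meetxx.

Let le0x (x : T) : (lzero : T) <= x :> T.
Proof.
by rewrite leEmeet; apply/eqP; rewrite -{2}(V0_joinK hA lzero x) (V0_join0 hA).
Qed.

Let lex1 (x : T) : x <= (lone : T) :> T.
Proof. by rewrite leEmeet meetC; apply/eqP/(V0_meet1 hA). Qed.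

HB.instance Definition _ :=
  @Order.hasBottom.Build Order.default_display T lzero le0x.
HB.instance Definition _ :=
  @Order.hasTop.Build Order.default_display T lone lex1.

End Reduct.

Definition expand d (L : tbDistrLatticeType d) (diff : L -> L -> L) : LStr :=
  @MkLStr L (@Order.join d L) (@Order.meet d L) diff \bot%O \top%O.

(* The library does not combine the top and bottom of ['I_n.+1] with its
   lattice structure; redeclaring the latter at ['I_n.+1] does. *)
HB.instance Definition _ (n : nat) := Order.Total.copy 'I_n.+1 (ordinal n.+1).

Definition two : tbDistrLatticeType _ := 'I_2.
Definition three : tbDistrLatticeType _ := 'I_3.
Definition three_2 : tbDistrLatticeType _ := (three *p three)%type.
Definition three_3_two : tbDistrLatticeType _ :=
  (three *p three *p three *p two)%type.

Definition overline (x : three) : three := if x == \bot%O then \bot%O else \top%O.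
Definition cube_e (x : two) : three := if x == \bot%O then \bot%O else \top%O.
Definition cube_r (x : three) : two := if x == \bot%O then \bot%O else \top%O.
Definition cube_f (x : three) : three_2 := (overline x, x).
Definition cube_g (x : three) : three_2 := (x, overline x).
Definition cube_a (p : three_2) : three_3_two :=
  (overline p.1, p.1, p.2, cube_r p.2).
Definition cube_b (p : three_2) : three_3_two :=
  (p.1, overline p.1, p.2, cube_r p.1).
Definition cube_c (p : three_2) : three_3_two :=
  (p.1, p.2, overline p.2, cube_r p.2).

(* A choice of the difference operations on the vertices of the cube; the
   suffix of a field is the index (a subset of {1,2,3}) of the vertex. *)
Record cube_choice := {
  diff0 : two -> two -> two;
  diff1 : three -> three -> three;
  diff2 : three -> three -> three;
  diff3 : three -> three -> three;
  diff12 : three_2 -> three_2 -> three_2;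
  diff13 : three_2 -> three_2 -> three_2;
  diff23 : three_2 -> three_2 -> three_2;
  diff123 : three_3_two -> three_3_two -> three_3_two;
  D0 := expand diff0;
  D1 := expand diff1;
  D2 := expand diff2;
  D3 := expand diff3;
  D12 := expand diff12;
  D13 := expand diff13;
  D23 := expand diff23;
  D123 := expand diff123;
  D0_V0 : V0 D0;
  D1_V0 : V0 D1;
  D2_V0 : V0 D2;
  D3_V0 : V0 D3;
  D12_V0 : V0 D12;
  D13_V0 : V0 D13;
  D23_V0 : V0 D23;
  D123_V0 : V0 D123;
  e_01 : Lembedding (cube_e : D0 -> D1);
  e_02 : Lembedding (cube_e : D0 -> D2);
  e_03 : Lembedding (cube_e : D0 -> D3);
  f_1_12 : Lembedding (cube_f : D1 -> D12);
  f_1_13 : Lembedding (cube_f : D1 -> D13);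
  g_2_12 : Lembedding (cube_g : D2 -> D12);
  f_2_23 : Lembedding (cube_f : D2 -> D23);
  g_3_13 : Lembedding (cube_g : D3 -> D13);
  g_3_23 : Lembedding (cube_g : D3 -> D23);
  a_12_123 : Lembedding (cube_a : D12 -> D123);
  b_13_123 : Lembedding (cube_b : D13 -> D123);
  c_23_123 : Lembedding (cube_c : D23 -> D123) }.

Definition card_lt (T U : Type) : Prop :=
  ([set: T] #<= [set: U])%card /\ ~ ([set: U] #<= [set: T])%card.

(* aleph_(m+1) is the least cardinal greater than aleph_m. *)
Fixpoint has_card_aleph (n : nat) (T : Type) : Prop :=
  match n with
  | 0 => ([set: T] #= [set: nat])%card
  | m.+1 => exists2 U : Type, has_card_aleph m U &
      card_lt U T /\
      forall W : Type, card_lt U W -> ([set: T] #<= [set: W])%card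
  end.

Definition card_ge_aleph (n : nat) (T : Type) : Prop :=
  exists2 U : Type, has_card_aleph n U & ([set: U] #<= [set: T])%card.

(* Main.v *)
Require Import Defs.
From HB Require Import structures.
From mathcomp Require Import all_boot all_order.
From mathcomp Require Import all_classical.
From mathcomp Require Import reals topology.
From mathcomp Require wochoice.

Set Implicit Arguments.
Unset Strict Implicit.
Unset Printing Implicit Defensive.

Import Order.TTheory.

Local Open Scope classical_set_scope.

(* If the spectrum of a distributive lattice L is a spectral subspace of the
   l-spectrum of an Abelian l-group, then the map (x, y) |-> (x y^-1) \/ 1 of the
   group induces a "Cevian" difference on L: an operation with
   a <= b \/ (a - b), (a - b) /\ (b - a) = 0 and a - e <= (a - b) \/ (b - e).
   For L the lattice of the free algebra F(I), each difference of two generators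
   involves only finitely many generators.  When card I >= aleph_2, Kuratowski's
   free set theorem yields three generators x1, x2, x3 such that xi - xj does not
   involve the third one.  Mapping them to the images in D of the middle elements
   of the three chains D_1, D_2, D_3, and all other generators to 0, the images of
   the differences xi - xj lie in the faces D_{i,j} of the cube, which contradicts
   the third (triangle) inequality at the factor 2 of D. *)

(** * Hull-kernel topologies *)

(* [pt x] is the ideal corresponding to the point [x]. *)
Definition cohull (T X : Type) (pt : X -> set T) (J : set T) : set X :=
  [set x | exists2 j, J j & ~ pt x j].

Definition outside (T X : Type) (pt : X -> set T) (t : T) : set X :=
  [set x | ~ pt x t].

Section HullKernelTopology.
Context {T : Type} {X : topologicalType} (pt : X -> set T).
Local Notation cohull := (cohull pt).
Local Notation outside := (outside pt).

Hypothesis openP : forall U : set X, open U <-> exists J, U = cohull J.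

Lemma open_outside t : open (outside t).
Proof.
apply/openP; exists [set t]; apply/seteqP; split=> x /=; first by exists t.
by case=> _ ->.
Qed.

(* In the patch topology the ultralimit of points is computed coordinatewise;
   it is also a limit in the coarser hull-kernel topology. *)
Lemma ultra_limit (F : set_system X) (x : X) : UltraFilter F ->
  pt x = [set t | F [set y | pt y t]] -> F --> x.
Proof.
move=> UF xE A; rewrite nbhsE => -[B [/openP[J ->] [j Jj nxj]] sBA].
suff: F (outside j) by apply: filterS => y nyj; apply: sBA; exists j.
have [Fj|//] := in_ultra_setVsetC [set y | pt y j] UF.
by case: nxj; rewrite xE.
Qed.

(** An ultrafilter containing [outside t] converges to its coordinatewise limit, which omits [t].
    What depends on the spectrum at hand is that this limit is again a point. *)
Lemma compact_outside t :
  (forall F : set_system X, UltraFilter F -> F (outside t) ->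
    exists x, pt x = [set u | F [set y | pt y u]]) ->
  compact (outside t).
Proof.
move=> limF; rewrite compact_ultra => F UF Ft; have [x xE] := limF F UF Ft.
exists x; split; last exact: ultra_limit xE.
move=> xt; have FC : F [set y | pt y t] by move: xt; rewrite xE.
by have [y [nyt yt]] := filter_ex (filterI Ft FC).
Qed.

Lemma closure_pt x y : closure [set y] x <-> pt y `<=` pt x.
Proof.
split=> [xy t yt|yx B].
  apply: contrapT => nxt.
  have /xy[z [/= -> nyt]] : nbhs x (outside t).
    by apply: open_nbhs_nbhs; split; [exact: open_outside|].
  exact: nyt.
rewrite nbhsE => -[C [/openP[J ->] [j Jj nxj]] sCB]; exists y; split=> //.
by apply: sCB; exists j => // /yx.
Qed.

Lemma closed_hull (A : set X) : closed A ->
  exists J : set T, A = [set x | J `<=` pt x].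
Proof.
rewrite -openC => /openP[J AJ]; exists J; rewrite -[LHS]setCK AJ.
apply/seteqP; split=> x /=.
  by move=> H j Jj; apply: contrapT => nxj; apply: H; exists j.
by move=> H [j /H].
Qed.

Lemma hull_closed (J : set T) : closed [set x | J `<=` pt x].
Proof.
rewrite -openC; apply/openP; exists J; apply/seteqP; split=> x /=.
  by move=> /existsNP[j /not_implyP[Jj nj]]; exists j.
by move=> [j Jj nj] H; exact/nj/H.
Qed.

End HullKernelTopology.

Lemma setC_hull (T : Type) (Q : set T -> Prop) (J : set T) :
  ~` @hull T Q J = cohull (fun P : {P : set T | Q P} => sval P) J.
Proof.
apply/seteqP; split=> x /=.
  by move=> /existsNP[j /not_implyP[Jj nj]]; exists j.
by move=> [j Jj nj] H; exact/nj/H.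
Qed.

(** If no [O t] contained [K], the differences of [K] and the [O t] would generate a proper filter,
    and a cluster point of it in [K] would lie in no [O t]. *)
Lemma compact_directed_cover (X : topologicalType) (T : Type) (O : T -> set X)
    (J : set T) (K : set X) :
  compact K -> (forall t, open (O t)) -> J !=set0 ->
  (forall s t, J s -> J t -> exists2 u, J u & O s `|` O t `<=` O u) ->
  K `<=` \bigcup_(t in J) O t -> exists2 t, J t & K `<=` O t.
Proof.
move=> cK oO [t0 Jt0] dirJ covK; apply: contrapT => nJ.
pose F := filter_from J (fun t => K `\` O t).
have FF : ProperFilter F.
  apply: filter_from_proper; last first.
    move=> t Jt; apply: contrapT => H; apply: nJ; exists t => // x Kx.
    by apply: contrapT => nOx; apply: H; exists x.
  apply: filter_from_filter; first by exists t0.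
  move=> s t /dirJ/[apply]-[u Ju stu]; exists u => // x [Kx nux].
  by split; split=> // H; apply: nux; apply: stu; [left|right].
have /(cK F FF)[x [Kx clx]] : F K by exists t0 => // x [].
have [t Jt xt] := covK x Kx.
have Nx : nbhs x (O t) by apply: open_nbhs_nbhs; split; [exact: oO|exact: xt].
have [//|y [[_ nyt] yt]] := clx (K `\` O t) (O t) _ Nx; first by exists t.
exact: nyt.
Qed.

(** * Spectra of distributive lattices *)

Section LatticeSpectrum.
Context {d : Order.disp_t} (L : bDistrLatticeType d).
Local Notation pt := (fun P : spectrum L => sval P).

Lemma spectrum_prime (P : spectrum L) : prime_ideal (sval P).
Proof. exact: svalP. Qed.

Lemma spectrum_openP (U : set (spectrum L)) :
  open U <-> exists J, U = cohull pt J.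
Proof.
by split=> -[J ->]; exists J; rewrite (@setC_hull _ (@prime_ideal d L)).
Qed.

Lemma spectrum_compact_outside (a : L) : compact (outside pt a).
Proof.
apply: (compact_outside spectrum_openP) => F UF Fa.
(* An ultralimit of prime ideals is prime: primeness holds because [F] decides every set, properness
   because [F] contains [outside pt a]. *)
have P : prime_ideal [set u : L | F [set y | sval y u]].
  split=> /=.
  - by apply: filterE => y /=; exact: (pi_bot (spectrum_prime y)).
  - move=> x y Fx Fy; apply: filterS2 Fx Fy => z /=; apply: (pi_join (spectrum_prime z)).
  - by move=> x y xy; apply: filterS => z /=; apply: (pi_down (spectrum_prime z) xy).
  - move=> FT; have Fa' : F [set y | sval y a] by have : [set: L] a; rewrite // -FT.
    by have [y [nyt yt]] := filter_ex (filterI Fa Fa').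
  - move=> x y Fxy.
    have [|Fnx] := in_ultra_setVsetC [set z : spectrum L | sval z x] UF; first by left.
    right; apply: filterS2 Fxy Fnx => z zxy nzx.
    by have [] := pi_prime (spectrum_prime z) zxy.
by exists (exist _ _ P).
Qed.

Lemma outsideU (a b : L) : outside pt (a `|` b)%O = outside pt a `|` outside pt b.
Proof.
apply/seteqP; split=> x /=; rewrite /outside /=.
  have [xa|//] := pselect (sval x a); last by left.
  by move=> H; right=> xb; apply: H; exact: pi_join (spectrum_prime x) _ _ xa xb.
by case=> H; apply: contra_not H; apply: (pi_down (spectrum_prime x)); rewrite ?leUl ?leUr.
Qed.

Lemma outsideI (a b : L) : outside pt (a `&` b)%O = outside pt a `&` outside pt b.
Proof.
apply/seteqP; split=> x /=; rewrite /outside /=.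
  by move=> H; split; apply: contra_not H; apply: (pi_down (spectrum_prime x));
    rewrite ?leIl ?leIr.
by case=> nxa nxb /(pi_prime (spectrum_prime x))[].
Qed.

Lemma compact_open_outside (a : L) : Defs.compact_open (outside pt a).
Proof.
by split; [exact: spectrum_compact_outside|exact: open_outside spectrum_openP a].
Qed.

(** The basic open sets inside [U] are directed under join and cover [U], so by compactness one of
    them is all of [U]. *)
Lemma compact_openP (U : set (spectrum L)) :
  Defs.compact_open U -> exists a, U = outside pt a.
Proof.
move=> [cU /[dup] oU /spectrum_openP[J UJ]].
have [|s t|x Ux|a aU Ua] :=
  @compact_directed_cover _ _ (outside pt) [set a | outside pt a `<=` U] U cU
    (open_outside spectrum_openP).
- by exists \bot%O => x /(_ (pi_bot (spectrum_prime x))).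
- move=> sU tU; exists (s `|` t)%O; last by rewrite outsideU.
  by rewrite /= outsideU => x [/sU|/tU].
- move: Ux; rewrite {1}UJ => -[j Jj nj]; exists j => //= y nyj.
  by rewrite UJ; exists j.
- by exists a; apply/seteqP.
Qed.

(** The generic point of [A] is the intersection of the ideals in [A]. If it contains the meet of
    [x] and [y], then [A] is the union of its closed subsets of ideals containing [x], respectively
    [y]; irreducibility then makes it prime. *)
Lemma spectrum_sober : sober (spectrum L).
Proof.
move=> A [cA [P0 AP0] irr]; have [J AJ] := closed_hull spectrum_openP cA.
have P : prime_ideal [set u : L | A `<=` [set P | sval P u]].
  split=> /=.
  - by move=> P _; exact: pi_bot (spectrum_prime P).
  - by move=> x y Ax Ay P AP; apply: (pi_join (spectrum_prime P)); [exact: Ax|exact: Ay].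
  - by move=> x y xy Ay P AP; apply: (pi_down (spectrum_prime P) xy); exact: Ay.
  - move=> AT; apply: (pi_proper (spectrum_prime P0)); apply/seteqP; split=> // x _.
    have : [set: L] x by []; rewrite -AT; exact.
  - move=> x y Axy.
    have clA z : closed (A `&` [set P : spectrum L | sval P z]).
      apply: closedI => //; have := @hull_closed _ _ _ (@spectrum_openP) [set z].
      by congr (closed _); apply/seteqP; split=> Q /=; [exact|move=> Qz _ ->].
    have [|E|E] := irr _ _ (clA x) (clA y).
    + apply/seteqP; split=> [Q AQ|Q [[]|[]]//].
      by have [] := pi_prime (spectrum_prime Q) (Axy Q AQ); [left|right].
    + by left=> Q; rewrite E => -[].
    + by right=> Q; rewrite E => -[].
exists (exist _ _ P); split=> [|Q AQ].
  apply/seteqP; split=> Q /=; rewrite (closure_pt spectrum_openP) /=.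
    by move=> AQ x; exact.
  by move=> H; rewrite AJ /= => j Jj; apply: H => R; rewrite AJ; exact.
apply: eq_sig_hprop => [R ? ?|/=]; first exact: Prop_irrelevance.
apply/seteqP; split=> x /=.
  by apply; rewrite AQ; exact: subset_closure.
move=> Qx R; rewrite AQ => /(closure_pt spectrum_openP); exact.
Qed.

Lemma spectrum_generalized_spectral : generalized_spectral (spectrum L).
Proof.
split; first exact: spectrum_sober.
- split=> [U []//|x A]; rewrite nbhsE => -[B [/spectrum_openP[J ->] [j Jj nxj]] sBA].
  exists (outside pt j); first by split=> //; exact: compact_open_outside.
  by move=> y nyj; apply: sBA; exists j.
- move=> _ _ /compact_openP[a ->] /compact_openP[b ->].
  by rewrite -outsideI; exact: spectrum_compact_outside.
Qed.

End LatticeSpectrum.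

(** A proper ideal omits [\top], so the whole space is a basic open set. *)
Lemma spectrum_spectral d (L : tbDistrLatticeType d) : spectral (spectrum L).
Proof.
split; first exact: spectrum_generalized_spectral.
have -> : [set: spectrum L] = outside (fun P : spectrum L => sval P) \top%O.
  apply/seteqP; split=> // x _ xT; apply: (pi_proper (spectrum_prime x)).
  by apply/seteqP; split=> // y _; exact: pi_down (spectrum_prime x) _ _ (lex1 y) xT.
exact: spectrum_compact_outside.
Qed.

(** Take [b] in [y] but not in [x], and [a] in [x] but not in [y]. Primeness of [z] puts one of the
    two differences of [a] and [b] into [z], hence into both [x] and [y], which forces [a] into [y]
    or [b] into [x]. *)
Lemma V0_completely_normal (A : LStr) (hA : V0 A) :
  completely_normal (spectrum (reduct hA)).
Proof.
move=> x y z.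
rewrite !(closure_pt (@spectrum_openP _ (reduct hA))) => zx zy.
apply: contrapT => /not_orP[].
move=> /existsNP[b /not_implyP[yb nxb]] /existsNP[a /not_implyP[xa nya]].
have hx := spectrum_prime x; have hy := spectrum_prime y.
have split_diff (P : spectrum (reduct hA)) (u v : reduct hA) :
    sval P v -> sval P (ldiff (u : A) v) -> sval P u.
  move=> Pv Pd; rewrite -(V0_diffE hA u v).
  apply: (pi_join (spectrum_prime P)) Pd.
  exact: (pi_down (spectrum_prime P) (leIr (v : reduct hA) u)).
have : sval z (ldiff (a : A) b : reduct hA) \/ sval z (ldiff (b : A) a : reduct hA).
  apply: (pi_prime (spectrum_prime z)).
  have -> : ((ldiff (a : A) b : reduct hA) `&` (ldiff (b : A) a : reduct hA))%O
    = \bot%O :> reduct hA by exact: (V0_diffI hA).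
  exact: pi_bot (spectrum_prime z).
case=> [/zy|/zx] H; [exact: nya (split_diff y _ _ yb H)|].
exact: nxb (split_diff x _ _ xa H).
Qed.

(** * Spectra of Abelian l-groups *)

Section AbelianLGroup.
Context {d : Order.disp_t} (G : abLGroupType d).
Local Open Scope group_scope.
Local Open Scope order_scope.
Implicit Types x y z : G.

Definition lpos x : G := x `|` 1%g.

(** Ideals do not distinguish [x] from [lnorm x], so every basic open set comes from an element
    above 1. *)
Definition lnorm x : G := (x `|` x^-1) `|` 1%g.

Lemma lg_le2Mr z x y : x <= y -> (x * z)%g <= (y * z)%g.
Proof. by rewrite ![(_ * z)%g]lg_mulC; exact: lg_le2M. Qed.

Lemma lg_le2MI z x y : (z * x)%g <= (z * y)%g -> x <= y.
Proof. by move/(lg_le2M z^-1%g); rewrite !mulKg. Qed.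

Lemma lg_leV x y : x <= y -> y^-1%g <= x^-1%g.
Proof.
by move=> xy; apply: (@lg_le2MI x); rewrite mulgV lg_mulC; apply: (@lg_le2MI y);
  rewrite mulVKg mulg1.
Qed.

Lemma lg_leM x y x' y' : x <= y -> x' <= y' -> (x * x')%g <= (y * y')%g.
Proof. by move=> /(lg_le2Mr x') xy /(lg_le2M y); exact: le_trans xy. Qed.

Lemma lg_mulU z x y : (z * (x `|` y))%g = (z * x)%g `|` (z * y)%g.
Proof.
apply/eqP; rewrite eq_le leUx !lg_le2M ?leUl ?leUr // !andbT.
apply: (@lg_le2MI z^-1%g); rewrite mulKg leUx.
by apply/andP; split; apply: (@lg_le2MI z); rewrite mulVKg ?leUl ?leUr.
Qed.

Lemma lpos_ge1 x : 1%g <= lpos x. Proof. exact: leUr. Qed.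

(** Write x+ for [lpos x] and w for z times the inverse of (x^-1)+, where z is the meet. Since x+ =
    x (x^-1)+, w is below both x and 1; hence (x^-1)+ <= w^-1, that is, z <= 1. *)
Lemma lposI x : lpos x `&` lpos x^-1%g = 1%g.
Proof.
apply/eqP; rewrite eq_le lexI !lpos_ge1 andbT.
set z := _ `&` _; have xE : lpos x = (x * lpos x^-1)%g.
  by rewrite /lpos lg_mulU mulgV mulg1 joinC.
have zx : z <= (x * lpos x^-1)%g by rewrite -xE leIl.
have z1 : z <= lpos x^-1%g by rewrite leIr.
have H1 : (z * (lpos x^-1)^-1)%g <= x.
  by have := lg_le2Mr (lpos x^-1)^-1%g zx; rewrite mulgK.
have H2 : (z * (lpos x^-1)^-1)%g <= 1%g.
  by have := lg_le2Mr (lpos x^-1)^-1%g z1; rewrite mulgV.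
have H3 : lpos x^-1%g <= (z * (lpos x^-1)^-1)^-1%g.
  rewrite leUx; apply/andP; split; first exact: lg_leV.
  by have := lg_leV H2; rewrite invg1.
have := lg_le2M (z * (lpos x^-1)^-1)%g _ _ H3.
by rewrite mulgVK mulgV andbT.
Qed.

Section Ideal.
Variables (P : set G) (iP : l_ideal P).

Lemma l_ideal_down x y : 1%g <= x -> x <= y -> P y -> P x.
Proof. by move=> x1 xy; exact: li_convex iP _ _ _ x1 xy (li_one iP). Qed.

Lemma l_ideal_norm x : P (lnorm x) <-> P x.
Proof.
split=> [Pn|Px].
  apply: (li_convex iP _ _ (li_inv iP Pn) Pn); last by rewrite lexU2 // leUl.
  by rewrite -[leRHS]invgK; apply: lg_leV; rewrite lexU2 // leUr.
by apply: (li_join iP _ (li_one iP)); apply: (li_join iP Px); exact: li_inv.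
Qed.

(** Because x <= (x/y)+ y. This lemma and the next two supply the three conditions on the Cevian
    difference. *)
Lemma l_ideal_lpos_div x y : 1%g <= x -> P y -> P (lpos (x * y^-1)%g) -> P x.
Proof.
move=> x1 Py Pd; apply: (l_ideal_down x1 _ (li_mul iP Pd Py)).
by rewrite -[leLHS](mulgVK y); apply: lg_le2Mr; exact: leUl.
Qed.

Lemma l_ideal_lpos_div_trans x y z :
  P (lpos (x * y^-1)%g) -> P (lpos (y * z^-1)%g) -> P (lpos (x * z^-1)%g).
Proof.
move=> Pxy Pyz; apply: (l_ideal_down (lpos_ge1 _) _ (li_mul iP Pxy Pyz)).
rewrite leUx; apply/andP; split.
  have -> : (x * z^-1 = (x * y^-1) * (y * z^-1))%g by rewrite mulgA mulgVK.
  by apply: lg_leM; exact: leUl.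
by rewrite -[leLHS]mulg1; apply: lg_leM; exact: lpos_ge1.
Qed.

End Ideal.

Lemma prime_l_ideal_lpos_div (P : set G) x y : prime_l_ideal P ->
  P (lpos (x * y^-1)%g) \/ P (lpos (y * x^-1)%g).
Proof.
move=> hP; apply: (pli_prime hP).
have -> : (y * x^-1 = (x * y^-1)^-1)%g by rewrite invgM invgK.
by rewrite lposI; exact: li_one (pli_ideal hP).
Qed.

End AbelianLGroup.

(** * Compact open sets of the l-spectrum *)

Section LSpectrum.
Context {d : Order.disp_t} (G : abLGroupType d).
Local Notation pt := (fun P : l_spectrum G => sval P).

Lemma l_spectrum_prime (P : l_spectrum G) : prime_l_ideal (sval P).
Proof. exact: svalP. Qed.

Lemma l_spectrum_openP (U : set (l_spectrum G)) :
  open U <-> exists J, U = cohull pt J.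
Proof.
by split=> -[J ->]; exists J; rewrite (@setC_hull _ (@prime_l_ideal d G)).
Qed.

Lemma l_spectrum_compact_outside (g : G) : compact (outside pt g).
Proof.
apply: (compact_outside l_spectrum_openP) => F UF Fg.
(* Any closure condition with two premises that all prime l-ideals satisfy passes to the
   ultralimit. *)
have F2 (Q1 Q2 Q3 : set G -> Prop) :
    (forall P, prime_l_ideal P -> Q1 P -> Q2 P -> Q3 P) ->
    F [set y | Q1 (sval y)] -> F [set y | Q2 (sval y)] -> F [set y | Q3 (sval y)].
  by move=> H F1 F2; apply: filterS2 F1 F2 => z; apply/H/l_spectrum_prime.
have P : prime_l_ideal [set u : G | F [set y | sval y u]].
  split=> /=.
  - split=> /=.
    + by apply: filterE => y /=; exact: (li_one (pli_ideal (l_spectrum_prime y))).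
    + move=> x y; apply: (F2 (@^~ x) (@^~ y) (@^~ (x * y)%g)).
      by move=> P /pli_ideal/li_mul; exact.
    + move=> x Fx; apply: (F2 (@^~ x) (@^~ x) (@^~ (x^-1)%g)) => // P.
      by move=> /pli_ideal/li_inv H + _; exact: H.
    + move=> x y z xy yz; apply: (F2 (@^~ x) (@^~ z) (@^~ y)) => P /pli_ideal iP.
      exact: (li_convex iP xy yz).
    + move=> x y; apply: (F2 (@^~ x) (@^~ y) (@^~ (x `&` y)%O)) => P.
      by move=> /pli_ideal/li_meet; exact.
    + move=> x y; apply: (F2 (@^~ x) (@^~ y) (@^~ (x `|` y)%O)) => P.
      by move=> /pli_ideal/li_join; exact.
  - move=> FT; have Fg' : F [set y | sval y g] by have : [set: G] g; rewrite // -FT.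
    by have [y [nyt yt]] := filter_ex (filterI Fg Fg').
  - move=> x y Fxy.
    have [|Fnx] := in_ultra_setVsetC [set z : l_spectrum G | sval z x] UF; first by left.
    right; apply: filterS2 Fxy Fnx => z zxy nzx.
    by have [] := pli_prime (l_spectrum_prime z) zxy.
by exists (exist _ _ P).
Qed.

(** The elements above 1 whose basic open sets lie in [W] are directed under join, and their basic
    open sets cover [K]. Above 1, a join lies in an ideal exactly when both terms do. *)
Lemma l_spectrum_compact_sub (K W : set (l_spectrum G)) :
  compact K -> open W -> K `<=` W ->
  exists g : G, [/\ (1%g <= g)%O, K `<=` outside pt g & outside pt g `<=` W].
Proof.
move=> cK /l_spectrum_openP[J ->] KW.
have [|g h|x Kx|g /= [g1 gW] Kg] := @compact_directed_cover _ _ (outside pt)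
    [set g | (1%g <= g)%O /\ outside pt g `<=` cohull pt J] K cK
    (open_outside l_spectrum_openP).
- exists 1%g; split=> // x; case.
  exact: (li_one (pli_ideal (l_spectrum_prime x))).
- move=> [g1 gW] [h1 hW].
  have E (x : l_spectrum G) : sval x (g `|` h)%O -> sval x g /\ sval x h.
    move=> H; have iP := pli_ideal (l_spectrum_prime x).
    by split; apply: (l_ideal_down iP _ _ H); rewrite ?leUl ?leUr.
  exists (g `|` h)%O.
    split; first exact: le_trans g1 (leUl _ _).
    move=> x nx; have [xg|/gW//] := pselect (sval x g).
    apply: hW => xh; apply: nx => /=.
    exact: (li_join (pli_ideal (l_spectrum_prime x))).
  by move=> x [] nx /= /E[].
- have [j Jj nj] := KW x Kx; exists (lnorm j).
    split=> [|y ny]; first by rewrite leUr.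
    exists j => // yj; apply: ny.
    exact/(l_ideal_norm (pli_ideal (l_spectrum_prime y))).
  by move=> /= /(l_ideal_norm (pli_ideal (l_spectrum_prime x))).
- by exists g.
Qed.

End LSpectrum.

(* Choose [g_a >= 1] in [G] for each [a] in [L]; the compact open set given by
   the positive part of [g_a / g_b] traces a compact open set on [X], which is
   that of some element of [L]. *)
Lemma cevian_of_spectral_subspace d (L : bDistrLatticeType d)
    d' (G : abLGroupType d') (X : set (l_spectrum G)) :
  spectral_subspace X -> homeomorphic (spectrum L) (set_type X) ->
  exists diff : L -> L -> L, forall P, prime_ideal P ->
    [/\ forall a b, P b -> P (diff a b) -> P a,
        forall a b, P (diff a b) \/ P (diff b a) &
        forall a b c, P (diff a b) -> P (diff b c) -> P (diff a c)].
Proof.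
move=> [_ _ Xspec] [f [f' [fK f'K cf cf']]].
pose phi P := sval (set_val (f P)).
have phi_prime P : prime_l_ideal (phi P) by exact: l_spectrum_prime.
(* The compact open subset of [X] corresponding to [a] is the trace of an open [W]; a basic open set
   squeezed between it and [W] has the same trace. *)
have ex_pos (a : L) :
    exists g : G, (1%g <= g)%O /\ forall P : spectrum L, sval P a <-> phi P g.
  have [cK oK] := compact_open_outside a.
  set K := outside _ a in cK oK; pose U := f' @^-1` K.
  have [W oW UW] : open U by exact: open_comp (fun x _ => cf' x) oK.
  have UE : U = f @` K.
    apply/seteqP; split=> [x Ux|_ [P KP <-]]; last by rewrite /U /= fK.
    by exists (f' x).
  have cU : compact (set_val @` U).
    apply: continuous_compact.
      exact/continuous_subspaceT/initial_continuous.
    by rewrite UE; apply: continuous_compact => //; exact: continuous_subspaceT.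
  have [|g [g1 Ug gW]] := l_spectrum_compact_sub cU oW.
    by rewrite -UW => _ [x + <-].
  exists g; split=> // P; split=> [Pa|Pg]; apply: contrapT => H.
    have /gW : outside (fun P : l_spectrum G => sval P) g (set_val (f P)) by [].
    rewrite -[W _]/((set_val @^-1` W) (f P)) UW /U /= fK; exact.
  have : (set_val @` U) (set_val (f P)) by exists (f P) => //; rewrite /U /= fK.
  by move=> /Ug; exact.
(* Spectrality of the inclusion makes the trace of the basic open set of [g] compact open, hence the
   basic open set of some [u] in [L]. *)
have ex_lat (g : G) : exists u : L, forall P : spectrum L, sval P u <-> phi P g.
  have [cV oV] : Defs.compact_open
      (set_val @^-1` (outside (fun P : l_spectrum G => sval P) g) : set (set_type X)).
    apply: Xspec; split; first exact: l_spectrum_compact_outside.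
    exact: (open_outside (@l_spectrum_openP _ G)).
  set V := _ @^-1` _ in cV oV.
  have [|u uE] := @compact_openP _ L (f @^-1` V).
    split; last exact: open_comp (fun x _ => cf x) oV.
    have -> : f @^-1` V = f' @` V.
      apply/seteqP; split=> [P VP|_ [x Vx <-]]; last by rewrite /= f'K.
      by exists (f P).
    by apply: continuous_compact => //; exact: continuous_subspaceT.
  exists u => P; have : (f @^-1` V) P = outside (fun Q : spectrum L => sval Q) u P by rewrite uE.
  rewrite /outside /= => E; split=> H; apply: contrapT => H'.
    have : (f @^-1` V) P by exact: H'.
    by rewrite /= E; exact.
  by have : V (f P) by [rewrite E|exact].
have /choice[pos posP] := ex_pos; have /choice[lat latP] := ex_lat.
exists (fun a b => lat (lpos (pos a * (pos b)^-1)%g)) => P hP.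
pose p : spectrum L := exist _ P hP; have iP := pli_ideal (phi_prime p).
have PE u : P (lat u) <-> phi p u by exact: (latP u p).
have Pa a : P a <-> phi p (pos a) by exact: ((posP a).2 p).
split=> [a b /Pa Pb /PE Pab|a b|a b c /PE Pab /PE Pbc].
- by apply/Pa; apply: (l_ideal_lpos_div iP (posP a).1 Pb Pab).
- by have [/PE|/PE] := prime_l_ideal_lpos_div (pos a) (pos b) (phi_prime p);
    [left|right].
- by apply/PE; exact: (l_ideal_lpos_div_trans iP Pab Pbc).
Qed.

(** * Free algebras *)

Record subalgebra (A : LStr) (S : set A) : Prop := Subalgebra {
  sub_join : forall x y, S x -> S y -> S (ljoin x y);
  sub_meet : forall x y, S x -> S y -> S (lmeet x y);
  sub_diff : forall x y, S x -> S y -> S (ldiff x y);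
  sub_zero : S lzero;
  sub_one : S lone }.

Lemma preimage_subalgebra (A B : LStr) (h : A -> B) (S : set B) :
  Lhom h -> subalgebra S -> subalgebra (h @^-1` S).
Proof.
move=> [hj hm hd h0 h1] [Sj Sm Sd S0 S1].
by split=> /= [x y|x y|x y||]; rewrite ?hj ?hm ?hd ?h0 ?h1; auto.
Qed.

Lemma range_subalgebra (A B : LStr) (h : A -> B) :
  Lhom h -> subalgebra (range h).
Proof.
move=> [hj hm hd h0 h1]; split.
- by move=> _ _ [x _ <-] [y _ <-]; rewrite -hj; exists (ljoin x y).
- by move=> _ _ [x _ <-] [y _ <-]; rewrite -hm; exists (lmeet x y).
- by move=> _ _ [x _ <-] [y _ <-]; rewrite -hd; exists (ldiff x y).
- by rewrite -h0; exists lzero.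
- by rewrite -h1; exists lone.
Qed.

(** [S] is itself an algebra [B] of the variety. The induced map from [F] to [B], followed by the
    inclusion, fixes the generators, so by uniqueness it is the identity. *)
Lemma free_generated (V : LStr -> Prop) (I : Type) (F : LStr) (eta : I -> F)
    (S : set F) :
  is_variety V -> is_free V eta -> subalgebra S -> (forall i, S (eta i)) ->
  forall u, S u.
Proof.
move=> [E VE] Ffree [Sj Sm Sd S0 S1] Seta u.
pose B := @MkLStr {x | S x}
  (fun x y => exist _ _ (Sj _ _ (svalP x) (svalP y)))
  (fun x y => exist _ _ (Sm _ _ (svalP x) (svalP y)))
  (fun x y => exist _ _ (Sd _ _ (svalP x) (svalP y)))
  (exist _ _ S0) (exist _ _ S1).
pose incl (x : B) : F := sval x.
have inclE v t : incl (Leval v t) = Leval (incl \o v) t.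
  by elim: t => //= t1 <- t2 <-.
have VB : V B.
  apply/VE => t1 t2 Et v; apply: eq_sig_hprop; first by move=> ? ? ?; exact: Prop_irrelevance.
  rewrite -!/(incl _) !inclE.
  by have /VE := free_mem Ffree; apply.
have [h [[hh hE] _]] := free_ext Ffree VB (fun i => exist _ _ (Seta i)).
have [k [_ kU]] := free_ext Ffree (free_mem Ffree) eta.
have k1 : k = incl \o h.
  apply: kU; split; last by move=> i /=; rewrite hE.
  by case: hh => hj hm hd h0 h1; split=> [x y|x y|x y||];
    rewrite /= ?hj ?hm ?hd ?h0 ?h1.
have k2 : k = id by exact: kU.
rewrite -[u]/(id u) -k2 k1; exact: svalP (h u).
Qed.

(** The elements with a finite support include the generators and form a subalgebra, since supports
    can be united. *)
Lemma free_finite_support (V : LStr -> Prop) (I : Type) (F : LStr)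
    (eta : I -> F) : is_variety V -> is_free V eta ->
  forall u, exists2 s : set I, finite_set s &
    forall S, subalgebra S -> (forall i, s i -> S (eta i)) -> S u.
Proof.
move=> Vv Ff; apply: (free_generated Vv Ff); last first.
  by move=> i; exists [set i]; [exact: finite_set1|move=> S _; apply].
have bin (x y w : F) :
    (forall S : set F, subalgebra S -> S x -> S y -> S w) ->
    (exists2 s : set I, finite_set s &
      forall S, subalgebra S -> (forall i, s i -> S (eta i)) -> S x) ->
    (exists2 s : set I, finite_set s &
      forall S, subalgebra S -> (forall i, s i -> S (eta i)) -> S y) ->
    exists2 s : set I, finite_set s &
      forall S, subalgebra S -> (forall i, s i -> S (eta i)) -> S w.
  move=> H [s fs sx] [t ft ty]; exists (s `|` t); first by rewrite finite_setU.
  move=> S hS st; apply: H => //; [apply: sx|apply: ty] => // i Hi; apply: st;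
    by [left|right].
split.
- by move=> x y; apply: bin => S hS; exact: sub_join.
- by move=> x y; apply: bin => S hS; exact: sub_meet.
- by move=> x y; apply: bin => S hS; exact: sub_diff.
- by exists set0 => // S hS _; exact: sub_zero.
- by exists set0 => // S hS _; exact: sub_one.
Qed.

(** * Prime ideals cut out by maps into a chain *)

Section ChainPoints.
Context (A : LStr) (hA : V0 A) {d : Order.disp_t} (C : orderType d).
Variable phi : A -> C.
Hypothesis phi_join : forall x y, phi (ljoin x y) = Order.max (phi x) (phi y).
Hypothesis phi_meet : forall x y, phi (lmeet x y) = Order.min (phi x) (phi y).

Lemma chain_prime_ideal t (u : A) : (phi lzero <= t)%O -> (t < phi u)%O ->
  @prime_ideal _ (reduct hA) [set x : A | (phi x <= t)%O].
Proof.
move=> t0 tu; split=> //=.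
- by move=> x y xt yt; rewrite phi_join ge_max xt.
- move=> x y xy; apply: le_trans.
  by rewrite -[x](meet_l xy) phi_meet ge_min lexx orbT.
- move=> E; have : [set: A] u by [].
  by rewrite -E /= leNgt tu.
- by move=> x y; rewrite phi_meet ge_min => /orP[]; [left|right].
Qed.

Hypothesis phi_zero : forall x, (phi lzero <= phi x)%O.

(** Otherwise, cutting at the maximum of [phi v] and [phi w] gives a prime ideal containing [v] and
    [w] but not [u]. *)
Lemma chain_le_max u v w :
  (forall P, @prime_ideal _ (reduct hA) P -> P v -> P w -> P u) ->
  (phi u <= Order.max (phi v) (phi w))%O.
Proof.
move=> H; rewrite leNgt; apply/negP => lt_u.
have t0 : (phi lzero <= Order.max (phi v) (phi w))%O by rewrite le_max phi_zero.
have hP := chain_prime_ideal t0 lt_u.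
have := H _ hP; rewrite /= !le_max !lexx orbT => /(_ isT isT).
by rewrite -le_max leNgt lt_u.
Qed.

Lemma chain_meet_zero u v :
  (forall P, @prime_ideal _ (reduct hA) P -> P u \/ P v) ->
  (phi u <= phi lzero)%O \/ (phi v <= phi lzero)%O.
Proof.
move=> H; have [|/negP] := pselect (phi u <= phi lzero)%O; first by left.
by rewrite -ltNge => lt_u; exact: (H _ (chain_prime_ideal (lexx _) lt_u)).
Qed.

End ChainPoints.

(** * Free sets *)

Lemma countable_setU (T : Type) (A B : set T) :
  countable A -> countable B -> countable (A `|` B).
Proof.
move=> cA cB; rewrite -bigcup2E; apply: bigcup_countable; first exact: countableP.
by move=> [|[|i]] _ //=; exact: countable0.
Qed.

Lemma injective_card_le (T U : Type) (f : T -> U) :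
  injective f -> ([set: T] #<= [set: U])%card.
Proof.
move=> fI; apply: card_le_trans (card_leT (range f)).
by have /card_eqPle[] : ([set: T] #= range f)%card
  by rewrite card_eq_sym; apply: inj_card_eq => x y _ _ /fI.
Qed.

Lemma card_le_injective (T U : Type) :
  ([set: T] #<= [set: U])%card -> exists f : T -> U, injective f.
Proof.
move=> /card_leP[f].
exists (fun x => set_val (f (SigSub (mem_set (I : [set: T] x))))) => x y /val_inj.
by move=> /(in2TT 'inj_f)/(congr1 set_val).
Qed.

Lemma not_countable_notin (U : Type) (A : set U) :
  ~ countable [set: U] -> countable A -> exists u, ~ A u.
Proof.
move=> cU cA; apply: contrapT => H; apply: cU; apply: sub_countable cA.
by apply: subset_card_le => u _; apply: contrapT => nA; apply: H; exists u.
Qed.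

(* Well-founded recursion picks a value not taken on the countably many predecessors. *)
Lemma countable_segments_card_le (T U : Type) (lt : T -> T -> Prop) :
  well_founded lt -> (forall x y, x <> y -> lt x y \/ lt y x) ->
  (forall y, countable [set x | lt x y]) -> ~ countable [set: U] ->
  ([set: T] #<= [set: U])%card.
Proof.
move=> wf tot cseg cU.
have [u0 _] := @not_countable_notin U set0 cU (@countable0 U).
(* The default [u0] is never reached: the values on the countably many predecessors leave some
   element of [U] free. *)
pose step y (rec : forall x, lt x y -> U) : U :=
  xget (u0 : {classic U}) [set u | forall x (h : lt x y), rec x h <> u].
pose f := Fix wf (fun _ => U) step.
have fE y : f y = step y (fun x _ => f x).
  apply: (Fix_eq wf (fun _ => U)) => x g g' gg'; congr (step _ _).
  by apply: functional_extensionality_dep => z; apply: functional_extensionality_dep.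
have fresh x y : lt x y -> f x <> f y.
  move=> xy; rewrite (fE y) /step; case: xgetP => [u _ H|H]; first exact: H xy.
  have [u nu] := not_countable_notin cU (sub_countable (card_image_le f _) (cseg y)).
  by case: (H u) => z zy fzu; apply: nu; exists z.
apply: (@injective_card_le _ _ f) => x y fxy; apply: contrapT => /tot[/fresh|/fresh];
  exact.
Qed.

(** The strict part of a well-order will do; totality, antisymmetry and transitivity are read off
    from least elements of sets of at most three points. *)
Lemma ex_well_founded (T : Type) : exists lt : T -> T -> Prop,
  [/\ well_founded lt, (forall x y, x <> y -> lt x y \/ lt y x) &
      forall x y z, lt x y -> lt y z -> lt x z].
Proof.
have [R Rwo] := @wochoice.well_ordering_principle {classic T}.
have Rmin (S : set T) : S !=set0 -> exists2 x, S x & forall y, S y -> R x y.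
  move=> [s Ss]; have [|x [[Sx xmin] _]] := Rwo [pred x | `[< S x >]].
    by exists s; apply/asboolP.
  by exists x; [exact/asboolP|move=> y /asboolP/xmin].
have Rtot x y : R x y \/ R y x.
  have [|z [->|->] zmin] := Rmin [set z | z = x \/ z = y]; first by exists x; left.
  - by left; apply: zmin; right.
  - by right; apply: zmin; left.
have Ranti x y : R x y -> R y x -> x = y.
  move=> xy yx; have Rxx : R x x by have [] := Rtot x x.
  have Ryy : R y y by have [] := Rtot y y.
  have [|z [_ zu]] := Rwo [pred z | `[< z = x \/ z = y >]].
    by exists x; apply/asboolP; left.
  rewrite -(zu x); first rewrite -(zu y) //.
    by split; [apply/asboolP; right|move=> t /asboolP[->|->]].
  by split; [apply/asboolP; left|move=> t /asboolP[->|->]].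
exists (fun x y => R x y /\ x <> y); split.
- move=> x; apply: contrapT => nx.
  have [|y ny ymin] := Rmin [set x | ~ Acc (fun x y => R x y /\ x <> y) x].
    by exists x.
  apply: ny; apply: Acc_intro => z [zy nzy]; apply: contrapT => nz.
  by apply: nzy; apply: Ranti => //; exact: ymin.
- by move=> x y nxy; have [] := Rtot x y; [left|right; split=> // /esym].
- move=> x y z [xy nxy] [yz nyz].
  have [|t txyz tmin] := Rmin [set t | [\/ t = x, t = y | t = z]].
    by exists x; constructor 1.
  have xz : x <> z by move=> E; apply: nxy; apply: Ranti; rewrite // E.
  split=> //; case: txyz tmin => -> tmin.
  - by apply: tmin; constructor 3.
  - by case: nxy; apply: Ranti => //; apply: tmin; constructor 1.
  - by case: nyz; apply: Ranti => //; apply: tmin; constructor 2.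
Qed.

(** If some segment is uncountable, [W] is the segment below the least point with this property;
    otherwise it is everything. *)
Lemma ex_omega1_subset (U : Type) : ~ countable [set: U] ->
  exists (W : set U) (lt : U -> U -> Prop),
  [/\ ~ countable W, well_founded lt,
      forall x y, x <> y -> lt x y \/ lt y x,
      forall x y z, lt x y -> lt y z -> lt x z &
      forall y, W y -> countable [set x | lt x y]].
Proof.
move=> cU; have [lt [wf tot tr]] := ex_well_founded U.
have [allc|/existsNP[y ny]] := pselect (forall y, countable [set x | lt x y]).
  by exists setT, lt.
elim/(well_founded_ind wf): y ny => y IH ny.
have [allc|/existsNP[z /not_implyP[zy nz]]] :=
  pselect (forall z, lt z y -> countable [set x | lt x z]).
  by exists [set x | lt x y], lt.
exact: IH nz.
Qed.

(* Were the union everything, ordering [I] first by the least [w] with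
   [x] in [A w] and then by a well-order would embed [I] into [U]. *)
Lemma omega1_union_proper (U I : Type) (W : set U) (lt : U -> U -> Prop)
    (A : U -> set I) :
  ~ countable [set: U] -> ~ ([set: I] #<= [set: U])%card ->
  well_founded lt -> (forall x y, x <> y -> lt x y \/ lt y x) ->
  (forall w, W w -> countable (A w)) ->
  (forall w w', lt w w' -> A w `<=` A w') ->
  exists i, forall w, W w -> ~ A w i.
Proof.
move=> cU nIU wf tot cA Amono; apply: contrapT => H; apply: nIU.
have cov i : exists w, W w /\ A w i.
  apply: contrapT => Hi; apply: H; exists i => w Ww Awi.
  by apply: Hi; exists w.
have minw i : exists w, [/\ W w, A w i & forall w', W w' -> A w' i -> ~ lt w' w].
  have [w [Ww Awi]] := cov i.
  elim/(well_founded_ind wf): w Ww Awi => w IH Ww Awi.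
  have [[w' [Ww' Aw'i w'w]]|nw] :=
    pselect (exists w', [/\ W w', A w' i & lt w' w]); first exact: IH w'w Ww' Aw'i.
  by exists w; split=> // w' Ww' Aw'i w'w; apply: nw; exists w'.
have /choice[rho rhoP] := minw.
have [lti [wfi toti _]] := ex_well_founded I.
(* All [lex]-predecessors of [j] lie in the countable set [A (rho j)]. *)
pose lex i j := lt (rho i) (rho j) \/ rho i = rho j /\ lti i j.
apply: (@countable_segments_card_le _ _ lex _ _ _ cU).
- move=> i; have [w wE] : exists w, rho i = w by exists (rho i).
  elim/(well_founded_ind wf): w i wE => w IHw i.
  elim/(well_founded_ind wfi): i => i IHi iw.
  apply: Acc_intro => j [ji|[ji ltji]]; first by apply: (IHw (rho j)); rewrite -?iw.
  by apply: IHi => //; rewrite ji.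
- move=> i j nij; have [E|/tot[]] := pselect (rho i = rho j).
  + by have [] := toti _ _ nij; [left; right|right; right].
  + by left; left.
  + by right; left.
- move=> j; have [Wj _ _] := rhoP j; apply: sub_countable (cA _ Wj).
  apply: subset_card_le => i; have [_ Ai _] := rhoP i.
  by case=> [/Amono|[<- _]]; exact.
Qed.

(* The case [n = 2] of Kuratowski's free set theorem. The set [W] is ordered in
   type omega_1, so that no arithmetic of uncountable cardinals is needed. *)
Lemma free_triple (I : Type) (Phi : I -> I -> set I) :
  (forall i j, finite_set (Phi i j)) -> card_ge_aleph 2 I ->
  exists i j k, [/\ i <> j, i <> k & j <> k] /\
  [/\ ~ (Phi i j `|` Phi j i) k, ~ (Phi i k `|` Phi k i) j &
      ~ (Phi j k `|` Phi k j) i].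
Proof.
move=> finPhi [U2 [U1 [U0 U0N [[U01 nU10] _]] [[U12 nU21] _]] U2I].
have cU1 : ~ countable [set: U1].
  by move=> c; apply: nU10; rewrite (card_le_eqr U0N).
have nIU1 : ~ ([set: I] #<= [set: U1])%card.
  by move=> H; apply: nU21; exact: card_le_trans U2I H.
have [g gI] := card_le_injective (card_le_trans U12 U2I).
pose Psi i j := Phi i j `|` Phi j i.
have finPsi i j : finite_set (Psi i j) by rewrite finite_setU.
have PsiC i j : Psi i j = Psi j i by exact: setUC.
have [W [lt [ncW wf tot tr cseg]]] := ex_omega1_subset cU1.
pose below w : set U1 := [set v | lt v w] `|` [set w].
(* For [v], [w] in [W], a point [k] outside every [B w] differs from [g w] and is not in
   [Psi (g v) (g w)], because both [v] and [w] are below the larger of them. *)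
pose B w : set I := (g @` below w) `|`
  \bigcup_(p in below w `*` below w) Psi (g p.1) (g p.2).
have below_mono w w' : lt w w' -> below w `<=` below w'.
  by move=> ww' v [vw|->]; left=> //; exact: tr vw ww'.
have [w Ww|w w' ww'|k kP] :=
  @omega1_union_proper U1 I W lt B cU1 nIU1 wf tot.
- have cb : countable (below w).
    by apply: countable_setU; [exact: cseg|exact: countable1].
  apply: countable_setU; first exact: sub_countable (card_image_le _ _) cb.
  apply: bigcup_countable; first exact: countableX.
  by move=> p _; exact: finite_set_countable.
- apply: setUSS; first exact/image_subset/below_mono.
  by move=> x [p [p1 p2] Px]; exists p => //; split; exact: (below_mono _ _ ww').
have gk w : W w -> g w <> k.
  by move=> Ww gw; apply: (kP w Ww); left; exists w => //; right.
have Psik v w : W v -> W w -> ~ Psi (g v) (g w) k.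
  have lt_case v' w' : W w' -> lt v' w' -> ~ Psi (g v') (g w') k.
    move=> Ww' vw HP; apply: (kP w' Ww'); right; exists (v', w') => //.
    by split; [left|right].
  move=> Wv Ww; have [->|/tot[]] := pselect (v = w).
  - by move=> HP; apply: (kP w Ww); right; exists (w, w) => //; split; right.
  - exact: lt_case.
  - by rewrite PsiC; exact: lt_case.
have [N [NW Ninf Ncount]] : exists N, [/\ N `<=` W, infinite_set N & countable N].
  have Winf : infinite_set W by move=> /finite_set_countable.
  have [f fI] : exists f : nat -> set_type W, injective f.
    apply: card_le_injective; move/infiniteP : Winf.
    by move=> /card_le_trans; apply; have /card_eqPle[] := card_setT W.
  exists (range (fun n => set_val (f n))); split.
  - by move=> _ [n _ <-]; exact: set_valP.
  - move=> fin; apply: infinite_nat; move: fin.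
    by rewrite (@eq_finite_set _ _ _ [set: nat])//; apply: inj_card_eq => m n _ _ /val_inj/fI.
  - exact: card_image_le.
(* As [W] is uncountable, [j] can be chosen outside the countable [N] with [g j] outside every
   finite set [Psi (g b) k], [b] in [N]. *)
have [j [Wj jP]] : exists j, W j /\
    ~ (N `|` \bigcup_(b in N) (g @^-1` Psi (g b) k)) j.
  apply: contrapT => nj; apply: ncW.
  have : countable (N `|` \bigcup_(b in N) (g @^-1` Psi (g b) k)).
    apply: countable_setU => //; apply: bigcup_countable => // b _.
    apply: finite_set_countable; apply: finite_preimage => // x y _ _; exact: gI.
  apply: sub_countable; apply: subset_card_le => j Wj; apply: contrapT => nj'.
  by apply: nj; exists j.
(* [N] is infinite and [Psi (g j) k] is finite. *)
have [i [Ni iP]] : exists i, N i /\ ~ Psi (g j) k (g i).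
  apply: contrapT => ni; apply: Ninf.
  apply: (@sub_finite_set _ _ (g @^-1` Psi (g j) k)).
    by move=> i Ni; apply: contrapT => nP; apply: ni; exists i.
  by apply: finite_preimage => // x y _ _; exact: gI.
exists (g i), (g j), k; split; split.
- by move=> /gI E; apply: jP; left; rewrite -E.
- exact/gk/NW.
- exact: gk.
- by apply: Psik => //; exact: NW.
- by move=> HP; apply: jP; right; exists i.
- exact: iP.
Qed.

(** * The top of the cube *)

Section CubeTop.
Variable c : cube_choice.
Local Notation D := (D123 c).

Definition coord1 (p : D) : 'I_3 := p.1.1.1.
Definition coord2 (p : D) : 'I_3 := p.1.1.2.
Definition coord3 (p : D) : 'I_3 := p.1.2.
Definition coord4 (p : D) : 'I_2 := p.2.

Definition chain_morphism d (C : orderType d) (pr : D -> C) : Prop :=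
  [/\ forall x y, pr (ljoin x y) = Order.max (pr x) (pr y),
      forall x y, pr (lmeet x y) = Order.min (pr x) (pr y) &
      forall x, (pr lzero <= pr x)%O].

Lemma coord_chain_morphism :
  [/\ chain_morphism coord1, chain_morphism coord2,
      chain_morphism coord3 & chain_morphism coord4].
Proof.
have j n (x y : 'I_n.+1) : Order.join x y = Order.max x y by exact: joinEtotal.
have m n (x y : 'I_n.+1) : Order.meet x y = Order.min x y by exact: meetEtotal.
split; split=> [x y|x y|x]; rewrite -?j -?m //; exact: le0x.
Qed.

Definition middle : three := Ordinal (isT : (1 < 3)%N).

(** The coordinates of the three vertices are (2,2,1,1), (2,1,2,1) and (1,2,2,1). By commutativity
    of the cube, [vertex1] also comes from D_{1,3} through [cube_b], and the other two from D_{2,3}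
    through [cube_c]. *)
Definition vertex1 : D := cube_a (cube_f middle).
Definition vertex2 : D := cube_a (cube_g middle).
Definition vertex3 : D := cube_b (cube_g middle).

End CubeTop.

(* The inequality a <= b \/ (a - b), read at single coordinates, forces the images
   of x1 - x2 and x2 - x3 to vanish at the last coordinate, and that of x1 - x3
   not to. *)
Lemma no_cevian_over_cube (c : cube_choice) (A : LStr) (hA : V0 A)
    (h : A -> D123 c) (diff : A -> A -> A) (x1 x2 x3 : A) :
  Lhom h ->
  (forall P, @prime_ideal _ (reduct hA) P ->
    [/\ forall a b, P b -> P (diff a b) -> P a,
        forall a b, P (diff a b) \/ P (diff b a) &
        forall a b e, P (diff a b) -> P (diff b e) -> P (diff a e)]) ->
  h x1 = vertex1 c -> h x2 = vertex2 c -> h x3 = vertex3 c ->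
  range (cube_a : D12 c -> D123 c) (h (diff x1 x2)) ->
  range (cube_a : D12 c -> D123 c) (h (diff x2 x1)) ->
  range (cube_b : D13 c -> D123 c) (h (diff x1 x3)) ->
  range (cube_c : D23 c -> D123 c) (h (diff x2 x3)) ->
  range (cube_c : D23 c -> D123 c) (h (diff x3 x2)) ->
  False.
Proof.
move=> hh cev h1 h2 h3 [p12 _ E12] [p21 _ E21] [p13 _ E13] [p23 _ E23] [p32 _ E32].
have cevian d (C : orderType d) (pr : D123 c -> C) : chain_morphism pr ->
    [/\ forall a b, (pr (h a) <= Order.max (pr (h b)) (pr (h (diff a b))))%O,
        forall a b, (pr (h (diff a b)) <= pr lzero)%O \/
          (pr (h (diff b a)) <= pr lzero)%O &
        forall a b e, (pr (h (diff a e)) <=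
          Order.max (pr (h (diff a b))) (pr (h (diff b e))))%O].
  move=> [prj prm pr0]; have [hj hm _ h0 _] := hh.
  have J x y : (pr \o h) (ljoin x y) = Order.max (pr (h x)) (pr (h y)).
    by rewrite /= hj prj.
  have M x y : (pr \o h) (lmeet x y) = Order.min (pr (h x)) (pr (h y)).
    by rewrite /= hm prm.
  have Z x : ((pr \o h) lzero <= (pr \o h) x)%O by rewrite /= h0.
  split.
  - move=> a b; apply: (chain_le_max (hA := hA) J M Z (u := a)) => P /cev[+ _ _].
    exact.
  - move=> a b; rewrite -h0; apply: (chain_meet_zero (hA := hA) J M) => P.
    by move=> /cev[_ + _]; exact.
  - move=> a b e; apply: (chain_le_max (hA := hA) J M Z) => P /cev[_ _].
    exact.
have [m1 m2 m3 m4] := coord_chain_morphism c.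
(* Each first inequality reads 2 <= max(1, t), so t = 2. Hence x1 - x3 is 2 at coordinate 1; x3 - x2
   is 2 and so x2 - x3 is 0 at coordinate 2; x2 - x1 is 2 and so x1 - x2 is 0 at coordinate 3.
   Through [cube_r] these values determine coordinate 4, where the triangle inequality becomes 1 <=
   0. *)
have [/(_ x1 x3) L13 _ _] := cevian _ _ _ m1.
have [/(_ x3 x2) L32 /(_ x2 x3) M23 _] := cevian _ _ _ m2.
have [/(_ x2 x1) L21 /(_ x1 x2) M12 _] := cevian _ _ _ m3.
have [_ _ /(_ x1 x2 x3) T] := cevian _ _ _ m4.
move: L13 L32 M23 L21 M12 T; rewrite h1 h2 h3 -E12 -E21 -E13 -E23 -E32.
case: p12 p21 p13 p23 p32 {E12 E21 E13 E23 E32} => [? y12] [? y21] [x13 ?] [x23 y23] [x32 y32].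
rewrite /coord1 /coord2 /coord3 /coord4 /=.
have topE (t : three) : (overline middle <= Order.max middle t)%O -> t = \top%O.
  by rewrite le_max; case/orP=> // H; apply/eqP; rewrite -le1x.
have top_bot (t : three) : (t <= \bot)%O \/ (\top <= \bot :> three)%O -> t = \bot%O.
  by case=> // H; apply/eqP; rewrite -lex0.
by move=> /topE -> /topE -> /top_bot -> /topE -> /top_bot ->.
Qed.

(** * Generators of the free algebra sent into the cube *)

Theorem corollary7p6 (c : cube_choice) (V : LStr -> Prop)
  (Vvariety : is_variety V) (DV : V (D123 c))
  (VV0 : forall A : LStr, V A -> V0 A)
  (I : Type) (F : LStr) (eta : I -> F) (Ffree : is_free V eta) :
  let Omega := spectrum (reduct (VV0 F (free_mem Ffree))) in
  (spectral Omega /\ completely_normal Omega) /\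
  (card_ge_aleph 2 I ->
    ~ exists (d : Order.disp_t) (G : abLGroupType d) (X : set (l_spectrum G)),
        spectral_subspace X /\ homeomorphic Omega (set_type X)).
Proof.
set hF := VV0 F (free_mem Ffree); move=> Omega.
split; first by split; [exact: spectrum_spectral|exact: V0_completely_normal].
move=> I2 [d [G [X [Xsub XE]]]].
have [diff cev] := cevian_of_spectral_subspace Xsub XE.
have supp (p : I * I) : exists s : set I, finite_set s /\
    forall S : set F, subalgebra S -> (forall i, s i -> S (eta i)) ->
      S (diff (eta p.1) (eta p.2)).
  have [s fs sS] := free_finite_support Vvariety Ffree (diff (eta p.1) (eta p.2)).
  by exists s.
have /choice[Phi PhiP] := supp.
have [i [j [k [[nij nik njk] [nk nj ni]]]]] :=
  @free_triple I (fun i j => Phi (i, j)) (fun i j => (PhiP (i, j)).1) I2.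
(* The remaining generators go to [lzero], which lies in every face. *)
pose f t : D123 c :=
  if pselect (t = i) then vertex1 c else
  if pselect (t = j) then vertex2 c else
  if pselect (t = k) then vertex3 c else lzero.
have [h [[hh hE] _]] := free_ext Ffree DV f.
have h1 : h (eta i) = vertex1 c by rewrite hE /f; case: pselect.
have h2 : h (eta j) = vertex2 c.
  by rewrite hE /f; case: pselect => [E|?]; [case: nij|case: pselect].
have h3 : h (eta k) = vertex3 c.
  rewrite hE /f; case: pselect => [E|?]; first by case: nik.
  by case: pselect => [E|?]; [case: njk|case: pselect].
(* The supports of both differences avoid [t], and the preimage of a face under [h] is a subalgebra,
   so it is enough that the generators other than [t] map into the face. *)
have face (B : LStr) (e : B -> D123 c) l m t : Lembedding e ->
    ~ (Phi (l, m) `|` Phi (m, l)) t ->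
    (forall s, s <> t -> range e (h (eta s))) ->
    range e (h (diff (eta l) (eta m))) /\ range e (h (diff (eta m) (eta l))).
  move=> [he _] nt Hs; have hS := preimage_subalgebra hh (range_subalgebra he).
  by split; [apply: (PhiP (l, m)).2 hS _|apply: (PhiP (m, l)).2 hS _] => s Ps /=;
    apply: Hs => E; apply: nt; rewrite -E; [left|right].
have faceE (B : LStr) (e : B -> D123 c) t : Lembedding e ->
    (forall s, s <> t -> [\/ s = i, s = j | s = k] -> range e (h (eta s))) ->
    forall s, s <> t -> range e (h (eta s)).
  move=> [he _] H s st; have [|n] := pselect [\/ s = i, s = j | s = k].
    exact: H.
  rewrite hE /f; case: pselect => [E|?]; first by case: n; constructor 1.
  case: pselect => [E|?]; first by case: n; constructor 2.
  case: pselect => [E|?]; first by case: n; constructor 3.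
  exact: sub_zero (range_subalgebra he).
have [|R12 R21] := face _ _ _ _ _ (a_12_123 c) nk.
  apply: faceE (a_12_123 c) _ => s sk [->|->|//]; rewrite ?h1 ?h2.
  - by exists (cube_f middle).
  - by exists (cube_g middle).
have [|R13 _] := face _ _ _ _ _ (b_13_123 c) nj.
  apply: faceE (b_13_123 c) _ => s sj [->|//|->]; rewrite ?h1 ?h3.
  - by exists (cube_f middle).
  - by exists (cube_g middle).
have [|R23 R32] := face _ _ _ _ _ (c_23_123 c) ni.
  apply: faceE (c_23_123 c) _ => s si [//|->|->]; rewrite ?h2 ?h3.
  - by exists (cube_f middle).
  - by exists (cube_g middle).
exact: (no_cevian_over_cube hh cev h1 h2 h3 R12 R21 R13 R23 R32).
Qed.
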